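(* Let $\kappa$ be an uncountable regular cardinal, and let $X$ be a Banach space which satisfies $(\mathcal B)$ and admits a generating strongly dispersed sequence $\{x_\alpha\}_{\alpha<\kappa}$. (i) If $\kappa=\omega_1$, then $X$ has the Separable Complementation Property (SCP). (ii) If $\kappa<\aleph_\omega$ and $\{x_\alpha\}_{\alpha<\kappa}$ is an M-basis, then $X$ has SCP. (iii) Let $\kappa=\aleph_k$, $0<k<\omega$, and let $Y\subset X$ be a separable subspace. Then there is a closed subspace $Z\subset X$ with $\mathrm{codens}(Z)\le\aleph_{k-1}$ and a separable subspace $W\supset Y$ which is complemented in $Z$. If $X$ additionally satisfies $(1\text{-}\mathcal B)$ in (i) or (ii), then $X$ has $1$-SCP. In all cases the complemented subspaces can be chosen in such a way that they are generated by subsequences of $\{x_\alpha\}_{\alpha<\kappa}$ (i.e. are closed linear spans of subsequences).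
   Context: Banach spaces are real and infinite-dimensional. $[A]$ is the closed linear span of $A$; $A$ is generating if $[A]=X$. $\mathbf B_X$ is the closed unit ball. $\mathrm{codens}(Z)=\mathrm{dens}(X/Z)$ is the density character of the quotient. $(\mathcal B)$: for every uncountable regular cardinal $\kappa$ and every decreasing sequence $\{Z_\alpha\}_{\alpha<\kappa}$ of closed linear subspaces of $X$ with $\bigcap_{\alpha<\kappa}Z_\alpha=\{0\}$, the set $\bigcap_{\alpha<\kappa}\overline{\mathbf B_X+Z_\alpha}$ is bounded. $(1\text{-}\mathcal B)$: for each such sequence $\bigcap_{\alpha<\kappa}\overline{\mathbf B_X+Z_\alpha}\subset\mathbf B_X$. $\{x_\alpha\}_{\alpha<\kappa}$ is strongly dispersed if $\bigcap_{\gamma<\kappa}[x_\alpha:\gamma<\alpha<\kappa]=\{0\}$ and this intersection is a proper subset of $[x_\alpha:\beta<\alpha<\kappa]$ for all $\beta<\kappa$. $\{x_\alpha\}$ is an M-basis of $X$ if there are $x_\alpha^*\in X^*$ with $x^*_\alpha(x_\beta)=\delta_{\alpha,\beta}$, $[x_\alpha:\alpha<\kappa]=X$ and $[x^*_\alpha:\alpha<\kappa]$ weak-star dense in $X^*$. $X$ has SCP (resp. $1$-SCP) if each separable subspace of $X$ is contained in a separable subspace of $X$ that is complemented in $X$ (resp. is the range of a projection of norm at most $1$ on $X$). *)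

(* Defs.v *)
From HB Require Import structures.
From mathcomp Require Import all_boot all_order all_algebra.
From mathcomp Require Import all_classical all_reals.
From mathcomp Require Import wochoice topology normedtype.

Set Implicit Arguments.
Unset Strict Implicit.
Unset Printing Implicit Defensive.

Import Order.TTheory GRing.Theory Num.Theory.
Import numFieldNormedType.Exports.

Local Open Scope classical_set_scope.
Local Open Scope card_scope.
Local Open Scope ring_scope.

(* A cardinal kappa is represented by an initial ordinal: a well-ordered type
   all of whose proper initial segments have smaller cardinality.  The index
   set {alpha < kappa} of a transfinite sequence is then the type itself. *)

Definition card_lt (T U : Type) (A : set T) (B : set U) : Prop :=
  A #<= B /\ ~ (B #<= A).

Definition cardinal_order d (K : orderType d) : Prop :=
  well_order (@Order.le d K) /\
  forall a : K, card_lt [set b : K | (b < a)%O] [set: K].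

Definition cofinal d (K : orderType d) (A : set K) : Prop :=
  forall a : K, exists2 b, A b & (a <= b)%O.

Definition uncountable_regular d (K : orderType d) : Prop :=
  [/\ cardinal_order K,
      ~ countable [set: K] &
      forall A : set K, cofinal A -> A #= [set: K]].

(* |A| = aleph_n.  Every cardinal below |A| is that of a subset of A, so the
   successor clause says that |A| is the successor cardinal of aleph_(n-1). *)
Fixpoint has_aleph (T : Type) (n : nat) (A : set T) : Prop :=
  if n is m.+1 then
    exists B : set T,
      [/\ B `<=` A, has_aleph m B, card_lt B A &
          forall C : set T, C `<=` A -> card_lt C A -> C #<= B]
  else A #= [set: nat].

(* |A| < aleph_omega *)
Definition lt_aleph_omega (T : Type) (A : set T) : Prop :=
  finite_set A \/ exists n, has_aleph n A.

(* dens(T) <= |B| *)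
Definition dens_le (T : topologicalType) (U : Type) (B : set U) : Prop :=
  exists2 D : set T, dense D & D #<= B.

Definition linear_subspace (R : realType) (V : lmodType R) (A : set V) : Prop :=
  submod_closed [in A].

Definition linear_span (R : realType) (V : lmodType R) (A : set V) : set V :=
  smallest (@linear_subspace R V) A.

Section Banach.
Context {R : realType} {X : completeNormedModType R}.
Implicit Types (Y Z W A : set X) (P : X -> X).

Definition closed_span A : set X := closure (linear_span A).

Definition generating A : Prop := closed_span A = [set: X].

Definition separable_set Y : Prop :=
  exists D : set X, [/\ countable D, D `<=` Y & Y `<=` closure D].

Definition unit_ball : set X := [set x | `|x| <= 1].

(* P is (the extension by arbitrary values to X of) a linear projection of Z
   onto W of operator norm at most C. *)
Definition projection_onto Z W P (C : R) : Prop :=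
  [/\ forall a u v, Z u -> Z v -> P (a *: u + v) = a *: P u + P v,
      W `<=` Z /\ P @` Z = W,
      forall z, Z z -> P (P z) = P z &
      forall z, Z z -> `|P z| <= C * `|z|].

Definition complemented_in Z W : Prop := exists P C, projection_onto Z W P C.

Definition one_complemented W : Prop :=
  exists P, projection_onto [set: X] W P 1.

(* The complemented subspaces are required to belong to the family G, which is
   everything in the separable complementation property itself. *)
Definition SCP_within (G : set (set X)) : Prop :=
  forall Y, linear_subspace Y -> separable_set Y ->
  exists W, [/\ Y `<=` W, separable_set W, complemented_in [set: X] W & G W].

Definition one_SCP_within (G : set (set X)) : Prop :=
  forall Y, linear_subspace Y -> separable_set Y ->
  exists W, [/\ Y `<=` W, separable_set W, one_complemented W & G W].

End Banach.

Definition infinite_dimensional (R : realType) (X : completeNormedModType R) :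
    Prop :=
  ~ exists2 A : set X, finite_set A & linear_span A = [set: X].

Definition SCP (R : realType) (X : completeNormedModType R) : Prop :=
  @SCP_within R X [set: set X].

Definition one_SCP (R : realType) (X : completeNormedModType R) : Prop :=
  @one_SCP_within R X [set: set X].

Record closedSubspace (R : realType) (X : completeNormedModType R) :=
  ClosedSubspace {
    subspace_set :> set X;
    subspace_linear : linear_subspace subspace_set;
    subspace_closed : closed subspace_set }.

Section Quotient.
Context {R : realType} {X : completeNormedModType R}.
Variable Z : closedSubspace X.

Definition subspace_mem : {pred X} := [in subspace_set Z].

HB.instance Definition _ := GRing.isZmodClosed.Build X subspace_mem
  (GRing.submod_closedB (subspace_linear Z)).

(* The quotient topology is that of the quotient norm. *)
Definition quotient_space : topologicalType :=
  quotient_topology (Quotient.quot subspace_mem).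

(* codens(Z) <= |B| *)
Definition codens_le (U : Type) (B : set U) : Prop := dens_le quotient_space B.

End Quotient.

Definition decreasing d (K : orderType d) (R : realType)
    (X : completeNormedModType R) (Z : K -> closedSubspace X) : Prop :=
  forall a b : K, (a <= b)%O -> Z b `<=` Z a.

(* \bigcap_alpha closure (B_X + Z_alpha) *)
Definition ball_hull (K : Type) (R : realType) (X : completeNormedModType R)
    (Z : K -> closedSubspace X) : set X :=
  \bigcap_a closure [set u + z | u in unit_ball & z in Z a].

Definition property_B (R : realType) (X : completeNormedModType R) : Prop :=
  forall d (K : orderType d) (Z : K -> closedSubspace X),
    uncountable_regular K -> decreasing Z -> \bigcap_a Z a = [set 0] ->
    bounded_set (ball_hull Z).

Definition property_1B (R : realType) (X : completeNormedModType R) : Prop :=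
  forall d (K : orderType d) (Z : K -> closedSubspace X),
    uncountable_regular K -> decreasing Z -> \bigcap_a Z a = [set 0] ->
    ball_hull Z `<=` unit_ball.

Section Sequences.
Context {d : Order.disp_t} {K : orderType d}.
Context {R : realType} {X : completeNormedModType R}.
Implicit Type x : K -> X.

Definition tail_span x (b : K) : set X :=
  closed_span (x @` [set a | (b < a)%O]).

Definition strongly_dispersed x : Prop :=
  \bigcap_g tail_span x g = [set 0] /\
  forall b, \bigcap_g tail_span x g `<` tail_span x b.

Definition dual_space : set (X -> R^o) := [set f | linear f /\ continuous f].

(* closed linear span in the dual norm *)
Definition dual_closed_span (F : set (X -> R^o)) : set (X -> R^o) :=
  [set f | dual_space f /\ forall e : R, 0 < e ->
    exists2 g, linear_span F g & forall u : X, `|f u - g u| <= e * `|u|].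

(* The weak-star topology is induced by that of pointwise convergence. *)
Definition weak_star_dense (F : set (X -> R^o)) : Prop :=
  F `<=` dual_space /\ dual_space `<=` closure (F : set {ptws X -> R^o}).

Definition M_basis x : Prop :=
  exists xs : K -> X -> R^o,
    [/\ forall a, dual_space (xs a),
        forall a b, xs a (x b) = (a == b)%:R,
        generating (range x) &
        weak_star_dense (dual_closed_span (range xs))].

(* W is the closed linear span of a subsequence of x; a subsequence is given
   by its set of indices. *)
Definition subsequence_span x (W : set X) : Prop :=
  exists J : set K, W = closed_span (x @` J).

End Sequences.

(* Main.v *)
Require Import Defs.
From HB Require Import structures.
From mathcomp Require Import all_boot all_order all_algebra.
From mathcomp Require Import all_classical all_reals.
From mathcomp Require Import topology normedtype.
From mathcomp Require Import wochoice interval_inference ring lra.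

(* Let Z_b = [x_a : a > b].  Property (B), applied to the tails Z_b, yields a C
   such that each u satisfies |u| <= C dist(u, Z_b) for some b: the distances
   increase with b, and a countable set of indices is bounded.  By regularity
   one b serves a whole set of fewer than kappa vectors, so for every A of
   cardinality less than kappa the sum [x_a : a in A] + Z_b is direct for some
   b, with a projection of norm at most C; this gives (iii).  Iterating omega
   times over initial segments produces a bounded J containing A such that X
   is the sum of [x_a : a in J] and [x_a : a not in J], with a projection of
   norm at most C; this gives (i).  For (ii) one descends through the alephs.
   If x is an M-basis then so is every subfamily, reindexed by an initial
   ordinal, and its tails intersect in 0 whatever the order, because a vector
   in the intersection is annihilated by all the coordinate functionals.  Hence
   the splitting applies again to [x_a : a in J], whose index set is smaller,
   and after finitely many steps the index set is countable. *)

Set Implicit Arguments.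
Unset Strict Implicit.
Unset Printing Implicit Defensive.

Import Order.TTheory GRing.Theory Num.Theory.
Import numFieldNormedType.Exports.

Local Open Scope classical_set_scope.
Local Open Scope card_scope.
Local Open Scope ring_scope.

(** * Cardinals of well-ordered types *)

Lemma injfun_card_le T U (A : set T) (B : set U) (f : T -> U) :
  (forall a, A a -> B (f a)) ->
  (forall a b, A a -> A b -> f a = f b -> a = b) -> A #<= B.
Proof.
move=> fAB fI.
have /injfunPex[g] : exists2 f : T -> U, set_fun A B f & set_inj A f.
  by exists f => // a b /set_mem Aa /set_mem Ab; exact: fI.
exact: inj_card_le g.
Qed.

(** The point [u0] supplies values off [A], so the injection can be a total function. *)
Lemma card_le_injfun T U (u0 : U) (A : set T) (B : set U) : A #<= B ->
  exists2 f : T -> U, (forall a, A a -> B (f a)) &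
    (forall a b, A a -> A b -> f a = f b -> a = b).
Proof.
elim/Ppointed: U => U in u0 B *; first by have := no u0.
by move=> /pcard_leP/injfunPex[f fAB fI]; exists f => // a b Aa Ab;
  apply: fI; exact: mem_set.
Qed.

Lemma card_eq_range T U (u0 : U) (A : set U) : [set: T] #= A ->
  exists2 g : T -> U, injective g & range g = A.
Proof.
elim/Ppointed: U => U in u0 A *; first by have := no u0.
move=> /pcard_eqP/bijPex[g [gA gI gS]]; exists g.
  by move=> a b; apply: gI; rewrite inE.
apply/seteqP; split=> [_ [a _ <-]|]; [exact: gA|exact: gS].
Qed.

Lemma card_le_nonempty T U (A : set T) (B : set U) :
  A #<= B -> A !=set0 -> B !=set0.
Proof.
move=> AB /set0P A0; apply/set0P; apply: contra A0 => /eqP B0.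
by move: AB; rewrite B0 card_le0.
Qed.

Lemma card_le_subset T U (A : set T) (B : set U) : A #<= B ->
  exists2 C : set U, C `<=` B & C #= A.
Proof.
have [->|/set0P A0 AB] := eqVneq A set0.
  by exists set0 => //; rewrite card_eq0.
have [u0 _] := card_le_nonempty AB A0.
have [f fB fI] := card_le_injfun u0 AB.
exists (f @` A); first by move=> _ [a Aa <-]; exact: fB.
by apply: inj_card_eq => a b /set_mem Aa /set_mem Ab; exact: fI.
Qed.

Lemma card_leX T U T' U' (A : set T) (B : set U) (A' : set T') (B' : set U') :
  A #<= A' -> B #<= B' -> A `*` B #<= A' `*` B'.
Proof.
have [->|/set0P[a Aa]] := eqVneq A set0; first by rewrite set0X card_ge0.
have [->|/set0P[b Bb]] := eqVneq B set0; first by rewrite setX0 card_ge0.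
move=> AA' BB'.
have [a' _] := card_le_nonempty AA' (ex_intro _ a Aa).
have [b' _] := card_le_nonempty BB' (ex_intro _ b Bb).
have [f fA fI] := card_le_injfun a' AA'.
have [g gB gI] := card_le_injfun b' BB'.
apply: (@injfun_card_le _ _ _ _ (fun p => (f p.1, g p.2))).
  by move=> p [/fA ? /gB ?].
by move=> [p q] [p' q'] [/= Ap Bq] [/= Ap' Bq'] [/fI-> // /gI->].
Qed.

(* The injection is built greedily: each element is sent to some value not
   taken by its predecessors, of which there are too few to exhaust E. *)
Lemma wf_card_le T U (lt : T -> T -> Prop) (D : set T) (E : set U) :
  well_founded lt ->
  (forall a b, D a -> D b -> [\/ a = b, lt a b | lt b a]) ->
  (forall a, D a -> ~ (E #<= [set b | D b /\ lt b a])) -> D #<= E.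
Proof.
move=> wf tot small.
have [->|/set0P[a0 Da0]] := eqVneq D set0; first by rewrite card_ge0.
have [u0 _] : E !=set0.
  apply/set0P/eqP => E0; apply: (small _ Da0).
  by rewrite E0 card_ge0.
pose G a (g : forall b, lt b a -> U) : U :=
  if pselect (exists u, E u /\ forall b (h : lt b a), D b -> g b h <> u) is left e
  then projT1 (cid e) else u0.
pose g := Fix wf (fun=> U) G.
have gE a : g a = G a (fun b _ => g b).
  apply: (Fix_eq wf (fun=> U) G) => b f f' ff'; congr (G b).
  by apply: functional_extensionality_dep => c;
     apply: functional_extensionality_dep => h; exact: ff'.
have gP a : D a -> E (g a) /\ forall b, lt b a -> D b -> g b <> g a.
  move=> Da; rewrite gE /G; case: pselect => [e|]; first by case: (cid e).
  move=> nu; exfalso; apply: (small _ Da).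
  apply: card_le_trans (card_image_le g _).
  apply: subset_card_le => u Eu; apply: contrapT => nim; apply: nu.
  by exists u; split=> // b ba Db gbu; apply: nim; exists b.
apply: (@injfun_card_le _ _ _ _ g) => [a /gP[]//|a b Da Db gab].
have [//|ab|ba] := tot _ _ Da Db.
- by have [_ /(_ _ ab Da)] := gP _ Db.
- by have [_ /(_ _ ba Db)] := gP _ Da; rewrite gab.
Qed.

Section WellOrder.
Context d (K : orderType d).
Hypothesis wK : well_order (@Order.le d K).

Lemma well_order_min (A : set K) : A !=set0 ->
  exists2 a, A a & forall b, A b -> (a <= b)%O.
Proof.
move=> [a Aa]; have [|m [[mA mm] _]] := wK (A := [in A]).
  by exists a; exact: mem_set.
by exists m => [|b Ab]; [exact: set_mem|apply: mm; exact: mem_set].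
Qed.

Lemma well_order_wf : well_founded (fun a b : K => (a < b)%O).
Proof.
move=> a; apply: contrapT => na.
have [b nb bm] := @well_order_min [set b | ~ Acc (fun a b : K => (a < b)%O) b]
  (ex_intro _ a na).
apply: nb; constructor => c cb; apply: contrapT => /bm.
by rewrite leNgt cb.
Qed.

End WellOrder.

(** Gödel's order on pairs: by maximum first, then lexicographically. All predecessors of a pair lie
    in the square of the closed segment up to its maximum, which keeps initial segments small. *)
Definition max_lex d (K : orderType d) (p q : K * K) : Prop :=
  let m (r : K * K) := Order.max r.1 r.2 in
  [\/ (m p < m q)%O, m p = m q /\ (p.1 < q.1)%O |
      [/\ m p = m q, p.1 = q.1 & (p.2 < q.2)%O]].

Lemma max_lex_wf d (K : orderType d) : well_order (@Order.le d K) ->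
  well_founded (@max_lex d K).
Proof.
move=> wK; have wf := well_order_wf wK.
suff H a : forall b c p, Order.max p.1 p.2 = a -> p.1 = b -> p.2 = c ->
    Acc (@max_lex d K) p by move=> p; exact: H.
elim/(well_founded_ind wf): a => a IHa b.
elim/(well_founded_ind wf): b => b IHb c.
elim/(well_founded_ind wf): c => c IHc p pa pb pc.
constructor => q [|[]|[]].
- by rewrite pa => qa; exact: (IHa _ qa).
- by rewrite pa pb => qa qb; exact: (IHb _ qb _ _ qa).
- by rewrite pa pb pc => qa qb qc; exact: (IHc _ qc _ qa qb).
Qed.

Lemma max_lex_total d (K : orderType d) (p q : K * K) :
  [\/ p = q, max_lex p q | max_lex q p].
Proof.
case: p q => [p1 p2] [q1 q2].
rewrite /max_lex /=.
case: (ltgtP (Order.max p1 p2) (Order.max q1 q2)) => [?|?|e].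
- by constructor 2; constructor 1.
- by constructor 3; constructor 1.
case: (ltgtP p1 q1) => [?|?|e1].
- by constructor 2; constructor 2.
- by constructor 3; constructor 2.
case: (ltgtP p2 q2) => [?|?|e2].
- by constructor 2; constructor 3.
- by constructor 3; constructor 3.
- by constructor 1; rewrite e1 e2.
Qed.

(** [A] and the rest of [B] are sent into two disjoint copies of [L] inside the square, marked by
    [i 0] and [i 1]. *)
Lemma card_leU T U (A B : set T) (L : set U) :
  [set: nat] #<= L -> L `*` L #<= L -> A #<= L -> B #<= L -> A `|` B #<= L.
Proof.
move=> natL LL AL BL; apply: card_le_trans LL.
have [l0 _] := card_le_nonempty natL (ex_intro _ 0%N I).
have [i iL iI] := card_le_injfun l0 natL.
have [f fL fI] := card_le_injfun l0 AL.
have [g gL gI] := card_le_injfun l0 BL.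
apply: (@injfun_card_le _ _ _ _
  (fun t => if pselect (A t) then (i 0%N, f t) else (i 1%N, g t))).
  move=> t; case: pselect => [At _|nAt Bt]; first by split; [exact: iL|exact: fL].
  by case: Bt => // Bt; split; [exact: iL|exact: gL].
move=> s t; case: pselect => [As _|nAs Bs]; case: pselect => [At _|nAt Bt] [].
- exact: fI.
- by move/(iI _ _ I I).
- by move/(iI _ _ I I).
- by case: Bs => // Bs; case: Bt => // Bt; exact: gI.
Qed.

Lemma card_le_closed_segment d (K : orderType d) U (L : set U) (a : K) :
  [set: nat] #<= L -> L `*` L #<= L ->
  [set b | (b < a)%O] #<= L -> [set b | (b <= a)%O] #<= L.
Proof.
move=> natL LL segL.
have -> : [set b : K | (b <= a)%O] = [set b | (b < a)%O] `|` [set a].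
  apply/seteqP; split=> b /=; rewrite le_eqVlt.
    by move=> /orP[/eqP|]; [right|left].
  by move=> [->|->]; rewrite ?eqxx// orbT.
apply: card_leU => //; apply: card_le_trans (natL).
exact: (countable1 a).
Qed.

(** Hessenberg's argument: a pair has at most |L| predecessors for [max_lex], too few to exhaust
    [K], so the pairs embed greedily into [K]. *)
Lemma card_le_setX d (K : orderType d) U (L : set U) :
  well_order (@Order.le d K) ->
  [set: nat] #<= L -> L `*` L #<= L ->
  (forall a : K, [set b | (b < a)%O] #<= L) -> ~ ([set: K] #<= L) ->
  [set: K] `*` [set: K] #<= [set: K].
Proof.
move=> wK natL LL segL KL; apply: (wf_card_le (max_lex_wf wK)).
  by move=> p q _ _; exact: max_lex_total.
move=> p _ Kp; apply: KL; apply: card_le_trans Kp _; apply: card_le_trans (LL).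
pose m := Order.max p.1 p.2.
have leL := card_le_closed_segment natL LL (segL m).
apply: card_le_trans (card_leX leL leL); apply: subset_card_le => q [_ qp].
have : (Order.max q.1 q.2 <= m)%O by case: qp => [/ltW|[->]|[->]].
by rewrite ge_max => /andP[].
Qed.

Lemma card_le_seq (T : eqType) U (A : set T) (L : set U) :
  [set: nat] #<= L -> L `*` L #<= L -> A #<= L ->
  [set s : seq T | forall t, t \in s -> A t] #<= L.
Proof.
move=> natL LL AL.
have [l0 Ll0] := card_le_nonempty natL (ex_intro _ 0%N I).
have [i iL iI] := card_le_injfun l0 natL.
have [f fL fI] := card_le_injfun l0 AL.
have [p pL pI] := card_le_injfun l0 LL.
(* This nested pairing is injective only on lists of equal length, so the final code also stores the
   length. *)
pose enc (s : seq T) := foldr (fun t u => p (f t, u)) l0 s.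
have encL s : (forall t, t \in s -> A t) -> L (enc s).
  elim: s => //= t s IH H; apply: pL; split=> /=.
    by apply: fL; apply: H; rewrite mem_head.
  by apply: IH => r rs; apply: H; rewrite inE rs orbT.
have encI s s' : (forall t, t \in s -> A t) -> (forall t, t \in s' -> A t) ->
    size s = size s' -> enc s = enc s' -> s = s'.
  elim: s s' => [|t s IH] [|t' s']//= H H' [ss'].
  have Hs r : r \in s -> A r by move=> rs; apply: H; rewrite inE rs orbT.
  have Hs' r : r \in s' -> A r by move=> rs; apply: H'; rewrite inE rs orbT.
  have At : A t by apply: H; rewrite mem_head.
  have At' : A t' by apply: H'; rewrite mem_head.
  have LLs : (L `*` L) (f t, enc s) by split; [exact: fL|exact: encL].
  have LLs' : (L `*` L) (f t', enc s') by split; [exact: fL|exact: encL].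
  by move=> /(pI _ _ LLs LLs')[/fI -> // /IH ->].
have LLs s : (forall t, t \in s -> A t) -> (L `*` L) (i (size s), enc s).
  by move=> Hs; split; [exact: iL|exact: encL].
apply: (@injfun_card_le _ _ _ _ (fun s => p (i (size s), enc s))).
  by move=> s /LLs; exact: pL.
move=> s s' Hs Hs' /(pI _ _ (LLs _ Hs) (LLs _ Hs'))[/(iI _ _ I I) ss'].
exact: encI.
Qed.

(** * Finite alephs: invariance, squares and regularity *)

Lemma has_aleph_infinite T n (A : set T) : has_aleph n A -> [set: nat] #<= A.
Proof.
elim: n A => [|n IH] A /=; first by rewrite card_eq_le => /andP[].
by move=> [B [/subset_card_le BA /IH nB _ _]]; exact: card_le_trans BA.
Qed.

Lemma card_lt_eq T U T' U' (A : set T) (B : set U) (A' : set T') (B' : set U') :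
  A #= A' -> B #= B' -> card_lt A B -> card_lt A' B'.
Proof.
move=> AA' BB'; rewrite /card_lt (card_le_eql AA') (card_le_eqr BB').
by rewrite (card_le_eql BB') (card_le_eqr AA').
Qed.

(** The subset witnessing the preceding aleph is copied from [A] into [B]; a smaller subset of [B]
    is copied back to [A], where the successor clause applies. *)
Lemma has_aleph_eq T U n (A : set T) (B : set U) :
  A #= B -> has_aleph n A -> has_aleph n B.
Proof.
elim: n A B => [|n IH] A B AB; first by move=> /=; rewrite (card_eql AB).
have [leAB leBA] : A #<= B /\ B #<= A by apply/andP; rewrite -card_eq_le.
move=> /= [A' [A'A hA' ltA' maxA']].
have [B' B'B BA'] := card_le_subset (card_le_trans (subset_card_le A'A) leAB).
exists B'; split=> //.
- by apply: IH hA'; rewrite card_eq_sym.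
- by apply: card_lt_eq AB ltA'; rewrite card_eq_sym.
move=> C CB ltC.
have [C' C'A CC'] := card_le_subset (card_le_trans (subset_card_le CB) leBA).
rewrite -(card_le_eql CC') (card_le_eqr BA'); apply: maxA' => //.
by apply: card_lt_eq ltC; rewrite card_eq_sym.
Qed.

Lemma has_aleph_lt T U n (A : set T) (C : set U) :
  has_aleph n.+1 A -> card_lt C A ->
  exists2 B : set T, has_aleph n B & C #<= B.
Proof.
move=> [B [BA hB ltB maxB]] ltC; exists B => //.
have [C' C'A CC'] := card_le_subset ltC.1.
rewrite -(card_le_eql CC'); apply: maxB => //.
by apply: card_lt_eq ltC => //; rewrite card_eq_sym.
Qed.

Section SubOrder.
Context d (K : orderType d) (P : pred K).

(** Index sets are types, so a part of [K] must itself become an ordered type before regularity or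
    property (B) can be applied to it. *)
Definition sub_order : Type := {a : K | P a}.
HB.instance Definition _ := SubChoice.on sub_order.
HB.instance Definition _ := [SubChoice_isSubOrder of sub_order by <: with d].

Lemma sub_order_le (u v : sub_order) : (u <= v)%O = (val u <= val v)%O.
Proof. by []. Qed.

Lemma sub_order_well_order :
  well_order (@Order.le d K) -> well_order (@Order.le d sub_order).
Proof.
move=> wK A [u uA].
have [|m [v Av <-] vmin] := well_order_min wK (A := val @` [set v | v \in A]).
  by exists (val u); exists u.
have lbv w : w \in A -> (v <= w)%O.
  by move=> wA; rewrite sub_order_le; apply: vmin; exists w.
exists v; split; first by split=> // w; exact: lbv.
move=> w [wA wmin]; apply/le_anti/andP; split; first exact: lbv.
exact: wmin.
Qed.

End SubOrder.

(* Every cardinal at most that of a well-ordered type is that of an initial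
   segment, namely of the points whose predecessors are fewer than B. *)
Lemma initial_segment d (K : orderType d) (B : set K) :
  well_order (@Order.le d K) ->
  exists2 P : pred K, cardinal_order (sub_order P) & [set: sub_order P] #= B.
Proof.
move=> wK; pose seg (a : K) := [set b | (b < a)%O].
pose P : pred K := fun a => `[< ~ (B #<= seg a) >].
have PP a : P a <-> ~ (B #<= seg a) by split=> /asboolP.
have Plow a b : (b < a)%O -> P a -> P b.
  move=> ba /PP nB; apply/PP => Bb; apply: nB; apply: card_le_trans Bb _.
  by apply: subset_card_le => c /= /lt_trans; exact.
have valE A : val @` A #= (A : set (sub_order P)).
  by apply: inj_card_eq => u v _ _; exact: val_inj.
have segE (a : sub_order P) : val @` [set b | (b < a)%O] = seg (val a).
  apply/seteqP; split=> [_ [b ba <-]//|b ba].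
  by exists (exist _ b (Plow _ _ ba (valP a))).
have KB : [set: sub_order P] #<= B.
  apply: (wf_card_le (well_order_wf (sub_order_well_order wK))).
    by move=> a b _ _; case: (ltgtP a b) => ?;
      [constructor 2|constructor 3|constructor 1].
  move=> a _; rewrite -[X in B #<= X]/([set b | True /\ (b < a)%O]).
  have -> : [set b : sub_order P | True /\ (b < a)%O] = [set b | (b < a)%O].
    by apply/seteqP; split=> b /=; [case|].
  rewrite -(card_le_eqr (valE _)) segE; exact/PP/valP.
have BK : B #<= [set: sub_order P].
  rewrite -(card_le_eqr (valE _)).
  have [all|/existsNP[a0 na0]] := pselect (forall a, P a).
    by apply: subset_card_le => b _; exists (exist _ b (all b)).
  (* The least point outside [P] has at least |B| predecessors, and all of them satisfy [P]. *)
  have [a na amin] := well_order_min wK (A := [set a | ~ P a]) (ex_intro _ a0 na0).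
  have : B #<= seg a by apply: contrapT => /PP.
  move/card_le_trans; apply; apply: subset_card_le => b ba.
  have Pb : P b by apply: contrapT => /amin; rewrite leNgt ba.
  by exists (exist _ b Pb).
exists P; last by rewrite card_eq_le KB BK.
split; first exact: sub_order_well_order.
move=> a; split; first exact: card_leT.
rewrite -(card_le_eqr (valE _)) segE => Ka; apply: (PP _).1 (valP a) _.
exact: card_le_trans BK Ka.
Qed.

(** By induction on [n]: [A] is replaced by an equinumerous initial ordinal, whose segments have at
    most the preceding aleph, already known to equal its square. *)
Lemma has_aleph_square d (K : orderType d) n (A : set K) :
  well_order (@Order.le d K) -> has_aleph n A -> A `*` A #<= A.
Proof.
elim: n d K A => [|n IH] d K A wK hA.
  have [AN NA] : A #<= [set: nat] /\ [set: nat] #<= A.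
    by apply/andP; rewrite -card_eq_le.
  apply: card_le_trans (card_leX AN AN) _; apply: card_le_trans NA.
  by have := card_nat2; rewrite card_eq_le setXTT => /andP[].
have [P cK' K'A] := initial_segment A wK.
have hK' : has_aleph n.+1 [set: sub_order P].
  by apply: has_aleph_eq hA; rewrite card_eq_sym.
have [AK' leK'A] : A #<= [set: sub_order P] /\ [set: sub_order P] #<= A.
  by move: K'A; rewrite card_eq_le => /andP[].
apply: card_le_trans (card_leX AK' AK') _; apply: card_le_trans leK'A.
have [L [_ hL ltL maxL]] := hK'; have [wK' segK'] := cK'.
apply: (card_le_setX wK' (has_aleph_infinite hL) (IH _ _ _ wK' hL)).
  by move=> a; apply: maxL => //; exact: segK'.
by case: ltL.
Qed.

(** A smaller cofinal set would cover [K] by at most |L| segments of size at most |L|. Sending [b]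
    to a cofinal point [g b] above it and to its code in the segment of [g b] would embed [K] into
    the square of [L]. *)
Lemma has_aleph_regular d (K : orderType d) n :
  cardinal_order K -> has_aleph n.+1 [set: K] -> uncountable_regular K.
Proof.
move=> cK hK; have [wK segK] := cK.
have [L [_ hL [_ ltL] maxL]] := hK.
have natL := has_aleph_infinite hL.
have LL := has_aleph_square wK hL.
split=> // [cntK|A cofA]; first by apply: ltL; exact: card_le_trans cntK natL.
rewrite card_eq_le card_leT andTb; apply: contrapT => nKA.
have AL : A #<= L by apply: maxL => //; split=> //; exact: card_leT.
have [l0 _] := card_le_nonempty natL (ex_intro _ 0%N I).
have leL (a : K) : [set b : K | (b <= a)%O] #<= L.
  by apply: card_le_closed_segment => //; apply: maxL => //; exact: segK.
have /choice[f fP] a : exists f : K -> K, (forall b, (b <= a)%O -> L (f b)) /\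
    (forall b c, (b <= a)%O -> (c <= a)%O -> f b = f c -> b = c).
  by have [f fL fI] := card_le_injfun l0 (leL a); exists f.
have /choice[g gP] b : exists a, A a /\ (b <= a)%O.
  by have [a Aa ba] := cofA b; exists a.
apply: ltL; apply: card_le_trans LL.
apply: card_le_trans (card_leX AL (card_lexx L)).
apply: (@injfun_card_le _ _ _ _ (fun b => (g b, f (g b) b))).
  by move=> b _; split=> /=; [case: (gP b)|apply: (fP _).1; case: (gP b)].
move=> b c _ _ [gbc]; rewrite gbc; apply: (fP _).2.
- by rewrite -gbc; case: (gP b).
- by case: (gP c).
Qed.

Lemma card_lt_bounded d (K : orderType d) (A : set K) :
  uncountable_regular K -> ~ ([set: K] #<= A) ->
  exists b : K, forall a, A a -> (a < b)%O.
Proof.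
move=> [_ _ regK] nKA; apply: contrapT => nb; apply: nKA.
suff /regK : cofinal A by rewrite card_eq_le => /andP[].
move=> a; apply: contrapT => na; apply: nb; exists a => b Ab.
by rewrite ltNge; apply/negP => ab; apply: na; exists b.
Qed.

Lemma countable_bounded d (K : orderType d) (A : set K) :
  uncountable_regular K -> countable A -> exists b : K, forall a, A a -> (a < b)%O.
Proof.
move=> uK cA; apply: card_lt_bounded => // KA; case: uK => _ + _; apply.
exact: card_le_trans KA cA.
Qed.

(** * Separated pairs of subspaces *)

Lemma exists_invS_lt (R : realType) (e : R) : 0 < e ->
  exists n : nat, n.+1%:R^-1 < e.
Proof.
move: e => _/posnumP[e]; have [n _ /(_ n (leqnn n))] := near_infty_natSinv_lt e.
by exists n.
Qed.

Section NormedSpace.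
Context {R : realType} {X : completeNormedModType R}.
Implicit Types (A B C D W Z : set X) (u v w z : X) (e r : R).

Lemma linear_subspaceP A : linear_subspace A <->
  A 0 /\ forall (a : R) u v, A u -> A v -> A (a *: u + v).
Proof.
split=> [[A0 AD]|[A0 AD]].
  split; first exact: set_mem.
  by move=> a u v /mem_set Au /mem_set Av; apply/set_mem/AD.
split; first exact: mem_set.
by move=> a u v /set_mem Au /set_mem Av; apply/mem_set/AD.
Qed.

Section Subspace.
Variable A : set X.
Hypothesis sA : linear_subspace A.

Lemma subspace0 : A 0.
Proof. by case/linear_subspaceP: sA. Qed.

Lemma subspaceP (a : R) u v : A u -> A v -> A (a *: u + v).
Proof. by case/linear_subspaceP: sA => _; apply. Qed.

Lemma subspaceD u v : A u -> A v -> A (u + v).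
Proof. by move=> Au Av; rewrite -[u]scale1r; exact: subspaceP. Qed.

Lemma subspaceZ (a : R) u : A u -> A (a *: u).
Proof. by move=> Au; rewrite -[_ *: _]addr0; apply: subspaceP => //; exact: subspace0. Qed.

Lemma subspaceN u : A u -> A (- u).
Proof. by move=> Au; rewrite -scaleN1r; exact: subspaceZ. Qed.

Lemma subspaceB u v : A u -> A v -> A (u - v).
Proof. by move=> Au /subspaceN; exact: subspaceD. Qed.

End Subspace.

Lemma linear_span_subspace A : linear_subspace (linear_span A).
Proof.
apply/linear_subspaceP; split=> [B [sB _]|a u v Au Av B [sB AB]].
  exact: subspace0.
by apply: subspaceP => //; [exact: Au|exact: Av].
Qed.

Lemma closure_normP A u :
  closure A u <-> forall e, 0 < e -> exists2 v, A v & `|u - v| < e.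
Proof.
split=> [clA e e0|H B /nbhs_normP[e e0 eB]].
  have [|v [Av uv]] := clA [set v | `|u - v| < e]; last by exists v.
  by apply/nbhs_normP; exists e.
by have [v Av uv] := H _ e0; exists v; split=> //; exact: eB.
Qed.

Lemma closure_linear_subspace A :
  linear_subspace A -> linear_subspace (closure A).
Proof.
move=> sA; apply/linear_subspaceP; split; first exact: subset_closure (subspace0 sA).
move=> a u v /closure_normP clu /closure_normP clv; apply/closure_normP => e e0.
(* Adding 1 avoids dividing by zero when [a] is 0. *)
have a0 : 0 < `|a| + 1 by rewrite ltr_wpDl.
have e20 : 0 < e / 2 by rewrite divr_gt0.
have [u' Au' uu'] := clu (e / 2 / (`|a| + 1)) (divr_gt0 e20 a0).
have [v' Av' vv'] := clv _ e20.
exists (a *: u' + v'); first exact: subspaceP.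
have -> : a *: u + v - (a *: u' + v') = a *: (u - u') + (v - v').
  by rewrite scalerBr opprD addrACA.
apply: le_lt_trans (ler_normD _ _) _; rewrite normrZ.
have : `|a| * `|u - u'| <= e / 2.
  move: uu'; rewrite ltr_pdivlMr // => uu'; apply/ltW; apply: le_lt_trans uu'.
  by rewrite mulrC ler_wpM2l // lerDl.
by move: vv'; lra.
Qed.

Lemma closed_span_subspace A : linear_subspace (closed_span A).
Proof. exact/closure_linear_subspace/linear_span_subspace. Qed.

Lemma closed_span_closed A : closed (closed_span A).
Proof. exact: closed_closure. Qed.

Lemma closed_span_min A C : linear_subspace C -> closed C -> A `<=` C ->
  closed_span A `<=` C.
Proof.
move=> sC cC AC; rewrite (closure_id C).1 //; apply: closureS.
exact: smallest_sub.
Qed.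

Lemma sub_linear_span A : A `<=` linear_span A.
Proof. exact: sub_gen_smallest. Qed.

Lemma sub_closed_span A : A `<=` closed_span A.
Proof. by move=> u Au; exact: subset_closure (sub_linear_span Au). Qed.

Lemma linear_spanS A B : A `<=` B -> linear_span A `<=` linear_span B.
Proof.
move=> AB; apply: smallest_sub; first exact: linear_span_subspace.
by move=> u /AB; exact: sub_linear_span.
Qed.

Lemma closed_spanS A B : A `<=` B -> closed_span A `<=` closed_span B.
Proof. by move=> AB; apply: closureS; exact: linear_spanS. Qed.

Lemma sumset_subspace W Z : linear_subspace W -> linear_subspace Z ->
  linear_subspace [set w + z | w in W & z in Z].
Proof.
move=> sW sZ; apply/linear_subspaceP; split.
  exists 0; first exact: subspace0.
  by exists 0; [exact: subspace0|rewrite addr0].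
move=> a _ _ [w Ww [z Zz <-]] [w' Ww' [z' Zz' <-]].
exists (a *: w + w'); first exact: subspaceP.
exists (a *: z + z'); first exact: subspaceP.
by rewrite scalerDr addrACA.
Qed.

End NormedSpace.

Section Separated.
Context {R : realType} {X : completeNormedModType R}.
Implicit Types (W Z : set X) (C : R).

(** For subspaces: the sum is direct and the projection onto [W] along [Z] has norm at most [C]. *)
Definition separated C W Z : Prop :=
  forall w z, W w -> Z z -> `|w| <= C * `|w + z|.

Lemma separated_closure C W Z : 0 < C -> separated C W Z ->
  separated C (closure W) (closure Z).
Proof.
move=> C0 sWZ w z /closure_normP clw /closure_normP clz.
apply/ler_addgt0Pr => e e0.
(* Moving [w] and [z] by less than [d] each costs [d] on the left and [2 * C * d] on the right,
   together [e]. *)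
have d0 : 0 < e / (1 + 2 * C) by rewrite divr_gt0 // ltr_wpDr ?mulr_ge0 // ltW.
set d := e / _ in d0.
have [w' Ww' ww'] := clw _ d0; have [z' Zz' zz'] := clz _ d0.
have wz := sWZ _ _ Ww' Zz'.
have h1 : `|w| <= `|w - w'| + `|w'| by rewrite -{1}(subrK w' w) ler_normD.
have h2 : `|w' + z'| <= `|w + z| + (`|w - w'| + `|z - z'|).
  have -> : w' + z' = (w + z) - ((w - w') + (z - z')).
    by rewrite [X in _ - X]addrACA -opprD opprB [RHS]addrC subrK.
  apply: le_trans (ler_normB _ _) _; rewrite lerD2l; exact: ler_normD.
have h3 : C * `|w' + z'| <= C * (`|w + z| + 2 * d).
  by rewrite ler_pM2l //; lra.
have -> : e = d + 2 * C * d.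
  rewrite /d -{1}[e / _]mul1r -mulrDl mulrCA divff ?mulr1 // gt_eqF //.
  by rewrite ltr_wpDr // mulr_ge0 // ltW.
lra.
Qed.

Lemma norm_complete (f : nat -> X) :
  (forall e : R, 0 < e -> exists N, forall n m, (N <= n)%N -> (N <= m)%N ->
     `|f n - f m| < e) ->
  exists l, forall e : R, 0 < e -> exists N, forall n, (N <= n)%N -> `|l - f n| < e.
Proof.
move=> cf; have : cvg (f @ \oo).
  apply/cauchy_cvgP/cauchy_exP => e e0; have [N HN] := cf _ e0.
  exists (f N); exists N => // n /= Nn; rewrite -ball_normE /=; exact: HN.
move=> /cvg_ex[l /cvgrPdist_lt fl]; exists l => e /fl[N _ HN]; exists N => n.
exact: HN.
Qed.

(** When sums w + z converge to u, separation makes their [W]-components Cauchy; with limit l, the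
    remainder u - l is a limit of the [Z]-components. *)
Lemma separated_sum_closed C W Z : 0 < C ->
  linear_subspace W -> linear_subspace Z -> closed W -> closed Z ->
  separated C W Z -> closed [set w + z | w in W & z in Z].
Proof.
move=> C0 sW sZ cW cZ sWZ.
apply/closure_id/seteqP; split; first exact: subset_closure.
move=> u /closure_normP clu.
have /choice[p pP] n : exists p : X * X,
    [/\ W p.1, Z p.2 & `|u - (p.1 + p.2)| < n.+1%:R^-1].
  have [|_ [w Ww [z Zz <-]] h] := clu n.+1%:R^-1; first by rewrite invr_gt0.
  by exists (w, z).
have [] := @norm_complete (fun n => (p n).1).
  move=> e e0; have [N HN] := exists_invS_lt (divr_gt0 e0 (mulr_gt0 (ltr0Sn R 1) C0)).
  have close n : (N <= n)%N -> `|u - ((p n).1 + (p n).2)| < e / (2 * C).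
    move=> Nn; have [_ _ /lt_le_trans] := pP n; apply.
    by apply/ltW; apply: le_lt_trans HN; rewrite lef_pV2 ?posrE // ler_nat.
  exists N => n m /close hn /close hm; have [Wn Zn _] := pP n; have [Wm Zm _] := pP m.
  have := sWZ _ _ (subspaceB sW Wn Wm) (subspaceB sZ Zn Zm).
  move/le_lt_trans; apply.
  have -> : (p n).1 - (p m).1 + ((p n).2 - (p m).2) =
      (u - ((p m).1 + (p m).2)) - (u - ((p n).1 + (p n).2)).
    by rewrite addrACA -opprD opprB [RHS]addrC subrKA.
  rewrite -[ltRHS](mulfVK (lt0r_neq0 C0)) [ltRHS]mulrC ltr_pM2l //.
  apply: le_lt_trans (ler_normB _ _) _.
  have -> : e / C = e / (2 * C) + e / (2 * C) by field; exact: lt0r_neq0.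
  exact: ltrD.
move=> l pl; exists l.
  rewrite (closure_id W).1 //; apply/closure_normP => e /pl[N HN].
  by exists (p N).1; [case: (pP N)|exact: HN].
exists (u - l); last by rewrite addrC subrK.
rewrite (closure_id Z).1 //; apply/closure_normP => e e0.
have e20 : 0 < e / 2 by rewrite divr_gt0.
have [N HN] := pl _ e20; have [M HM] := exists_invS_lt e20.
pose n := maxn N M; have [Wn Zn hn] := pP n.
exists (p n).2 => //.
have -> : u - l - (p n).2 = (u - ((p n).1 + (p n).2)) - (l - (p n).1).
  by rewrite -!addrA -!opprD; congr (u - _); rewrite [RHS]addrC addrA subrK.
apply: le_lt_trans (ler_normB _ _) _.
have h1 := HN n (leq_maxl _ _).
have h2 : n.+1%:R^-1 <= M.+1%:R^-1 :> R.
  by rewrite lef_pV2 ?posrE // ler_nat ltnS leq_maxr.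
have h3 := lt_trans (lt_le_trans hn h2) HM.
by move: h1 h3; lra.
Qed.

Lemma separated_projection C W Z :
  linear_subspace W -> linear_subspace Z -> separated C W Z ->
  exists P, projection_onto [set w + z | w in W & z in Z] W P C.
Proof.
move=> sW sZ sWZ.
have uniqW w w' z z' : W w -> W w' -> Z z -> Z z' -> w + z = w' + z' -> w = w'.
  move=> Ww Ww' Zz Zz' e; apply/eqP; rewrite -subr_eq0 -normr_le0.
  have := sWZ _ _ (subspaceB sW Ww Ww') (subspaceB sZ Zz Zz').
  by rewrite addrACA -opprD e subrr normr0 mulr0.
(* The [W]-component of [u], unique by separation; outside the sum the value is 0. *)
pose P u := xget 0 [set w | W w /\ Z (u - w)].
have PE w z : W w -> Z z -> P (w + z) = w.
  move=> Ww Zz; rewrite /P; case: xgetP => [w' _ [Ww' Zw']|nw].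
    by apply: (uniqW _ _ _ _ Ww' Ww Zw' Zz); rewrite addrC subrK.
  by have [] := nw w; split=> //; rewrite addrC addKr.
exists P; split.
- move=> a _ _ [w Ww [z Zz <-]] [w' Ww' [z' Zz' <-]].
  rewrite scalerDr addrACA !PE //; exact: subspaceP.
- have WP w : W w -> P w = w.
    by move=> Ww; rewrite -{1}[w]addr0 PE //; exact: subspace0.
  split=> [w Ww|].
    by exists w => //; exists 0; [exact: subspace0|rewrite addr0].
  apply/seteqP; split=> [_ [_ [w Ww [z Zz <-]] <-]|w Ww]; first by rewrite PE.
  by exists w; [exists w => //; exists 0; [exact: subspace0|rewrite addr0]|exact: WP].
- move=> _ [w Ww [z Zz <-]]; rewrite PE // -{1}[w]addr0 PE //; exact: subspace0.
- by move=> _ [w Ww [z Zz <-]]; rewrite PE //; exact: sWZ.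
Qed.

Lemma projection_comp U V W P Q C D : 0 <= D ->
  projection_onto U V P C -> projection_onto V W Q D ->
  projection_onto U W (Q \o P) (D * C).
Proof.
move=> D0 [Plin [VU PUV] PP Pb] [Qlin [WV QVW] QQ Qb].
have PV u : U u -> V (P u) by move=> Uu; rewrite -PUV; exists u.
have PI v : V v -> P v = v by rewrite -PUV => -[u Uu <-]; exact: PP.
have QW v : V v -> W (Q v) by move=> Vv; rewrite -QVW; exists v.
split=> /=.
- by move=> a u v Uu Uv; rewrite Plin // Qlin //; exact: PV.
- split; first exact: subset_trans WV VU.
  apply/seteqP; split=> [_ [u Uu <-]|w]; first exact/QW/PV.
  rewrite -QVW => -[v Vv <-]; exists v; first exact: VU.
  by rewrite /= PI.
- by move=> u Uu; rewrite PI ?QQ //; [exact: PV|exact/WV/QW/PV].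
- move=> u Uu; apply: le_trans (Qb _ (PV _ Uu)) _.
  by rewrite -mulrA ler_wpM2l //; exact: Pb.
Qed.

End Separated.

(** * Separation from the tails of a sequence *)

Section RationalSpan.
Context {R : realType} {X : completeNormedModType R} {K : eqType}.
Implicit Types (x : K -> X) (J : set K) (s : seq (rat * K)).

Definition rat_comb x s : X := \sum_(t <- s) ratr t.1 *: x t.2.

(** A dense part of the span that is no larger than an infinite [J]. Lists may repeat an index, so
    adding combinations is concatenating lists. *)
Definition rat_span x J : set X :=
  rat_comb x @` [set s : seq (rat * K) | forall t, t \in s -> J t.2].

Lemma rat_span_sub x J : rat_span x J `<=` linear_span (x @` J).
Proof.
move=> _ [s Js <-]; have sL := linear_span_subspace (x @` J).
rewrite /rat_comb; elim: s Js => [|t s IH] Js.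
  by rewrite big_nil; exact: subspace0.
rewrite big_cons; apply: (subspaceP sL).
  by apply: sub_linear_span; exists t.2 => //; apply: Js; rewrite mem_head.
by apply: IH => r rs; apply: Js; rewrite inE rs orbT.
Qed.

Lemma closure_rat_span_subspace x J : linear_subspace (closure (rat_span x J)).
Proof.
apply/linear_subspaceP; split.
  by apply: subset_closure; exists [::] => //; rewrite /rat_comb big_nil.
move=> a u v /closure_normP clu /closure_normP clv; apply/closure_normP => e e0.
have e30 : 0 < e / 3 by rewrite divr_gt0.
have u0 : 0 < `|u| + 1 by rewrite ltr_wpDl.
(* The rational scalar comes first, since the precision required in approximating [u] depends on it.
   Each of the three error terms gets [e / 3]. *)
have [q qa] : exists q : rat, `|a - ratr q| < e / 3 / (`|u| + 1).
  have d0 : 0 < e / 3 / (`|u| + 1) by rewrite divr_gt0.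
  have [|q] := @rat_in_itvoo R (a - e / 3 / (`|u| + 1)) (a + e / 3 / (`|u| + 1)).
    by move: d0; lra.
  rewrite in_itv /= => /andP[q1 q2]; exists q.
  by rewrite ltr_norml; move: q1 q2; lra.
have q0 : 0 < `|ratr q : R| + 1 by rewrite ltr_wpDl.
have [_ [s Js <-] us] := clu (e / 3 / (`|ratr q| + 1)) (divr_gt0 e30 q0).
have [_ [s' Js' <-] vs'] := clv (e / 3) e30.
exists (ratr q *: rat_comb x s + rat_comb x s').
  exists ([seq (q * t.1, t.2) | t <- s] ++ s').
    by move=> t; rewrite mem_cat => /orP[/mapP[r rs ->]|]; [exact: (Js _ rs)|exact: Js'].
  rewrite /rat_comb big_cat big_map scaler_sumr; congr (_ + _).
  by apply: eq_bigr => t _; rewrite rmorphM scalerA.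
set us1 := rat_comb x s in us *; set vs1 := rat_comb x s' in vs' *.
have -> : a *: u + v - (ratr q *: us1 + vs1) =
    (a - ratr q) *: u + ratr q *: (u - us1) + (v - vs1).
  by rewrite scalerBl scalerBr subrKA opprD addrACA.
apply: le_lt_trans (ler_normD _ _) _.
have h1 : `|(a - ratr q) *: u| <= e / 3.
  rewrite normrZ; move: qa; rewrite ltr_pdivlMr // => qa; apply: ltW.
  by apply: le_lt_trans qa; rewrite ler_wpM2l // lerDl.
have h2 : `|ratr q *: (u - us1)| <= e / 3.
  rewrite normrZ; move: us; rewrite ltr_pdivlMr // => us; apply: ltW.
  by apply: le_lt_trans us; rewrite mulrC ler_wpM2l // lerDl.
have h3 := ler_normD ((a - ratr q) *: u) (ratr q *: (u - us1)).
by move: h1 h2 h3 vs'; lra.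
Qed.

Lemma closed_span_sub_rat_span x J :
  closed_span (x @` J) `<=` closure (rat_span x J).
Proof.
apply: closed_span_min; [exact: closure_rat_span_subspace|exact: closed_closure|].
move=> _ [a Ja <-]; apply: subset_closure; exists [:: (1%Q, a)].
  by move=> t; rewrite inE => /eqP ->.
by rewrite /rat_comb big_seq1 rmorph1 scale1r.
Qed.

Lemma card_rat_span x J U (L : set U) : [set: nat] #<= L -> L `*` L #<= L ->
  J #<= L -> rat_span x J #<= L.
Proof.
move=> natL LL JL; apply: card_le_trans (card_image_le _ _) _.
apply: (@card_le_seq _ _ [set t : rat * K | J t.2]) => //.
apply: card_le_trans LL; apply: card_le_trans (card_leX _ JL).
  by apply: (@subset_card_le _ _ ([set: rat] `*` J)).
by apply: card_le_trans natL; exact: countableP.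
Qed.

Lemma separable_closed_span x J :
  countable J -> separable_set (closed_span (x @` J)).
Proof.
move=> cJ; exists (rat_span x J); split.
- apply: card_rat_span => //; have := card_nat2.
  by rewrite card_eq_le setXTT => /andP[].
- by move=> u /rat_span_sub; exact: subset_closure.
- exact: closed_span_sub_rat_span.
Qed.

(** Each point of a countable dense part of [Y] is a limit of countably many finite combinations;
    [A] collects the indices occurring in all of them. *)
Lemma separable_countable_support x (Y : set X) :
  generating (range x) -> separable_set Y ->
  exists2 A : set K, countable A & Y `<=` closed_span (x @` A).
Proof.
move=> gx [D [cD DY YD]].
have /choice[s sP] (p : X * nat) : exists s, `|p.1 - rat_comb x s| < p.2.+1%:R^-1.
  have /closure_normP/(_ p.2.+1%:R^-1) : closure (rat_span x setT) p.1.
    by apply: closed_span_sub_rat_span; rewrite gx.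
  by rewrite invr_gt0 ltr0Sn => /(_ isT)[_ [s _ <-] h]; exists s.
pose A := \bigcup_(p in D `*` [set: nat]) [set t.2 | t in [set` s p]].
have subA d n t : D d -> t \in s (d, n) -> A t.2.
  by move=> Dd ts; exists (d, n) => //; exists t.
exists A.
  apply: bigcup_countable => [|p _]; first exact: countableX.
  by apply/finite_set_countable/finite_image/finite_seq.
apply: subset_trans YD _; rewrite (closure_id (closed_span _)).1; last first.
  exact: closed_span_closed.
apply: closureS => d Dd; apply/closure_normP => e e0.
have [n ne] := exists_invS_lt e0.
exists (rat_comb x (s (d, n))); last exact: lt_trans (sP (d, n)) ne.
by apply: rat_span_sub; exists (s (d, n)) => // t; exact: subA.
Qed.

End RationalSpan.

(** * Norm bounds from the hull of a decreasing sequence *)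

Section Hull.
Context {R : realType} {X : completeNormedModType R}.
Context {d : Order.disp_t} {K : orderType d}.
Variable Z : K -> closedSubspace X.
Hypotheses (uK : uncountable_regular K) (decZ : decreasing Z).
Variable C : R.
Hypotheses (C0 : 0 < C) (hullC : forall u, ball_hull Z u -> `|u| <= C).

(* The distance from u to Z b increases with b, so it is at least |u| / C - 1/n
   from some b_n on; by regularity the b_n have an upper bound. *)
Lemma hull_bound (u : X) : exists b, forall z, subspace_set (Z b) z -> `|u| <= C * `|u + z|.
Proof.
have step (n : nat) : exists b, forall z, subspace_set (Z b) z ->
    `|u| / C - n.+1%:R^-1 <= `|u + z|.
  apply: contrapT => nb; set r := `|u| / C - n.+1%:R^-1 in nb *.
  have {}nb b : exists2 z, subspace_set (Z b) z & `|u + z| < r.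
    apply: contrapT => nz; apply: nb; exists b => z Zz; rewrite leNgt.
    by apply/negP => h; apply: nz; exists z.
  (* [K] is nonempty, being uncountable, so some norm lies below [r]. *)
  have r0 : 0 < r.
    case: uK => _ nc _; have [[b _]|nK] := pselect ([set: K] !=set0).
      by have [z _] := nb b; exact: le_lt_trans (normr_ge0 _).
    suff K0 : [set: K] = set0 by case: nc; rewrite K0.
    by apply/seteqP; split=> // b _; case: nK; exists b.
  (* If every [Z b] came within [r] of [u], then [u / r] would lie in the hull and |u| would be at
     most C r, which is |u| minus a positive number. *)
  have /hullC : ball_hull Z (r^-1 *: u).
    move=> b _; apply: subset_closure; have [z Zz uz] := nb b.
    have sZ := subspace_linear (Z b).
    exists (r^-1 *: (u + z)).
      rewrite /unit_ball /= normrZ gtr0_norm ?invr_gt0 //.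
      by rewrite mulrC ler_pdivrMr // mul1r ltW.
    exists (- (r^-1 *: z)); first by apply: subspaceN => //; exact: subspaceZ.
    by rewrite scalerDr addrK.
  rewrite normrZ gtr0_norm ?invr_gt0 // mulrC ler_pdivrMr // /r mulrBr mulrCA.
  rewrite divff ?lt0r_neq0 // mulr1.
  have : 0 < C * n.+1%:R^-1 by rewrite mulr_gt0 ?invr_gt0.
  by rewrite lerBrDr gerDl leNgt => ->.
have /choice[f fP] := step.
have [|b bf] := @countable_bounded _ _ (range f) uK.
  exact: card_le_trans (card_image_le _ _) (countableP _).
exists b => z Zz; rewrite mulrC -ler_pdivrMr //.
apply/ler_addgt0Pr => e e0; have [n ne] := exists_invS_lt e0.
have : subspace_set (Z (f n)) z by apply: decZ Zz; apply/ltW/bf; exists n.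
by move=> /fP h; have := lerD h (ltW ne); rewrite subrK.
Qed.

(** The indices attached to the points of [D] have a common upper bound by regularity, and the
    inequality passes to the closure. *)
Lemma hull_bound_closure (D : set X) : ~ ([set: K] #<= D) ->
  exists b, separated C (closure D) (Z b).
Proof.
move=> nKD; have /choice[f fP] := hull_bound.
have [|b bf] := @card_lt_bounded _ _ (f @` D) uK.
  by move=> KD; apply: nKD; exact: card_le_trans KD (card_image_le _ _).
exists b; rewrite (closure_id (Z b)).1; last exact: subspace_closed.
apply: separated_closure => // w z Dw Zz; apply: fP; apply: decZ Zz.
by apply/ltW/bf; exists w.
Qed.

End Hull.

(** * Splitting the index set of a sequence *)

Section Splitting.
Context {R : realType} {X : completeNormedModType R}.
Context {d : Order.disp_t} {K : orderType d}.
Variable x : K -> X.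

Definition tail_subspace (b : K) : closedSubspace X :=
  ClosedSubspace (closed_span_subspace (x @` [set a | (b < a)%O]))
    (@closed_span_closed R X _).

Lemma tail_subspace_decreasing : decreasing tail_subspace.
Proof.
move=> a b ab; apply: closed_spanS; apply: image_subset => c /=.
exact: le_lt_trans.
Qed.

Hypothesis uK : uncountable_regular K.
Variable L : set K.
Hypotheses (natL : [set: nat] #<= L) (LL : L `*` L #<= L).
Hypotheses (nKL : ~ ([set: K] #<= L)).
Hypothesis segL : forall a : K, [set b | (b < a)%O] #<= L.
Variable C : R.
Hypotheses (C0 : 0 < C).
Hypothesis hullC : forall u, ball_hull tail_subspace u -> `|u| <= C.

(** The rational span of [A] is dense in its closed span and has at most |L| elements, fewer than
    [K]. *)
Lemma separated_tail (A : set K) : A #<= L ->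
  exists b, separated C (closed_span (x @` A)) (tail_span x b).
Proof.
move=> AL; have nKA : ~ ([set: K] #<= rat_span x A).
  by move=> KA; apply: nKL; apply: card_le_trans KA _; exact: card_rat_span.
have [b sb] := hull_bound_closure uK tail_subspace_decreasing C0 hullC nKA.
by exists b => w z Ww; apply: sb; exact: closed_span_sub_rat_span.
Qed.

(* J is the union of initial segments J_0, J_1, ... such that the span of
   J_n is separated from the tail after the supremum of J_(n+1). *)
Lemma separated_split (A : set K) (a0 : K) : (forall a, A a -> (a < a0)%O) ->
  exists J : set K, [/\ A `<=` J, exists b, J `<=` [set a | (a < b)%O] &
    separated C (closed_span (x @` J)) (closed_span (x @` (~` J)))].
Proof.
move=> Aa0; pose seg b := [set a : K | (a < b)%O].
(* Tails are strict, so a point beyond the tail index is taken: the separated part then contains all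
   indices from [g b] on, exactly the complement of [seg (g b)]. *)
have /choice[g gP] b : exists c, (b < c)%O /\
    separated C (closed_span (x @` seg b)) (closed_span (x @` [set a | (c <= a)%O])).
  have [c sc] := separated_tail (segL b).
  have [|c' cc'] := @countable_bounded _ _ [set b; c] uK.
    exact/finite_set_countable/finite_set2.
  exists c'; split=> [|w z Ww Zz]; first by apply: cc'; left.
  apply: sc => //; apply: closed_spanS Zz; apply: image_subset => a /=.
  by apply: lt_le_trans; apply: cc'; right.
pose f k := iter k g a0; have fS k : f k.+1 = g (f k) by [].
have fm k m : (k <= m)%N -> (f k <= f m)%O.
  elim: m => [|m IH]; first by rewrite leqn0 => /eqP ->.
  rewrite leq_eqVlt => /orP[/eqP->//|]; rewrite ltnS => /IH /le_trans; apply.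
  by rewrite fS ltW //; case: (gP (f m)).
pose J := \bigcup_k seg (f k).
exists J; split; first by move=> a /Aa0 ?; exists 0%N.
  have [|b bf] := @countable_bounded _ _ (range f) uK.
    exact: card_le_trans (card_image_le _ _) (countableP _).
  exists b => a [k _] /= /lt_trans; apply; apply: bf; by exists k.
(* The segments increase, so each finite combination over [J] lives on one of them. *)
have spanJ : linear_span (x @` J) `<=` \bigcup_k linear_span (x @` seg (f k)).
  apply: smallest_sub; last first.
    by move=> _ [a [k _ ak] <-]; exists k => //; apply: sub_linear_span; exists a.
  apply/linear_subspaceP; split.
    by exists 0%N => //; exact: subspace0 (linear_span_subspace _).
  move=> r u v [k _ uk] [m _ vm]; exists (maxn k m) => //.
  apply: (subspaceP (linear_span_subspace _)).
    apply: linear_spanS uk; apply: image_subset => a /= /lt_le_trans; apply.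
    by apply: fm; exact: leq_maxl.
  apply: linear_spanS vm; apply: image_subset => a /= /lt_le_trans; apply.
  by apply: fm; exact: leq_maxr.
apply: separated_closure => // w z /spanJ[k _ wk] Zz.
(* Indices outside [J] are in particular not below [f k.+1], which is [g (f k)]. *)
have [_ sk] := gP (f k); apply: sk; first exact: subset_closure.
apply: subset_closure; apply: linear_spanS Zz; apply: image_subset => a /= nJa.
by rewrite leNgt -fS; apply/negP => ak; apply: nJa; exists k.+1.
Qed.

End Splitting.

(** * The Hahn-Banach theorem and M-bases *)

Section HahnBanach.
Context {R : realType} {X : completeNormedModType R}.
Variable u : X.

(** Graphs of partial linear functionals dominated by the norm. The first clause is conditional so
    that the empty graph, the union of the empty chain, qualifies in Zorn's lemma. *)
Let dominated_graph (G : set (X * R)) : Prop :=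
  [/\ forall p, G p -> G (u, `|u|),
      forall (a : R) p q, G p -> G q -> G (a *: p.1 + q.1, a * p.2 + q.2) &
      forall p, G p -> p.2 <= `|p.1|].

Let dominated_graph_maximal : exists G, dominated_graph G /\
  forall H, G `<` H -> ~ dominated_graph H.
Proof.
apply: Zorn_bigcup => F FP totF; split.
- by move=> p [G FG Gp]; exists G => //; have [+ _ _] := FP _ FG; apply; exact: Gp.
- move=> a p q [G FG Gp] [H FH Hq]; have [GH|HG] := totF _ _ FG FH.
    by exists H => //; have [_ + _] := FP _ FH; apply => //; exact: GH.
  by exists G => //; have [_ + _] := FP _ FG; apply => //; exact: HG.
- by move=> p [G FG Gp]; have [_ _] := FP _ FG; apply.
Qed.

Lemma norming_functional : exists f : X -> R, [/\ f u = `|u|,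
  forall (a : R) v w, f (a *: v + w) = a * f v + f w & forall v, `|f v| <= `|v|].
Proof.
have [G [[Gu Glin Gdom] Gmax]] := dominated_graph_maximal.
(* A maximal graph is not empty: the functional on the line through [u] would extend it. *)
have G0u : G (u, `|u|).
  apply: contrapT => nG; have G0 p : ~ G p by move=> /Gu.
  apply: (Gmax [set (t *: u, t * `|u|) | t in [set: R]]).
    split=> [p /G0//|/(_ (u, `|u|))]; apply: contra_not nG; apply.
    by exists 1; rewrite ?scale1r ?mul1r.
  split=> [p _|a _ _ [t _ <-] [s _ <-]|_ [t _ <-]].
  - by exists 1; rewrite ?scale1r ?mul1r.
  - by exists (a * t + s) => //=; rewrite scalerDl scalerA mulrDl mulrA.
  - by rewrite /= normrZ ler_wpM2r // ler_norm.
have G00 : G (0, 0).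
  by have := Glin (-1) _ _ G0u G0u; rewrite /= scaleN1r mulN1r !addNr.
have Gtot w : exists r, G (w, r).
  apply: contrapT => nw.
  (* The value [c] assigned to a new vector [w] must lie above all elements of [S] and below all
     numbers [|q.1 + w| - q.2]; the supremum of [S] does. *)
  pose S := [set p.2 - `|p.1 - w| | p in G].
  have Sub p q : G p -> G q -> p.2 - `|p.1 - w| <= `|q.1 + w| - q.2.
    move=> Gp Gq; rewrite lerBlDr addrAC lerBrDr.
    have := Gdom _ (Glin 1 _ _ Gp Gq); rewrite /= scale1r mul1r.
    move=> /le_trans; apply.
    have -> : p.1 + q.1 = (q.1 + w) + (p.1 - w).
      by rewrite addrACA subrr addr0 addrC.
    exact: ler_normD.
  have supS : has_sup S.
    split; first by exists (0 - `|0 - w|), (0, 0).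
    exists (`|0 + w| - 0) => _ [p Gp <-]; exact: (Sub p (0, 0)).
  pose c := sup S.
  have cl p : G p -> p.2 - `|p.1 - w| <= c.
    by move=> Gp; apply: ub_le_sup; [case: supS|exists p].
  have cu q : G q -> c <= `|q.1 + w| - q.2.
    move=> Gq; apply: ge_sup; first by case: supS.
    by move=> _ [p Gp <-]; exact: Sub.
  apply: (Gmax [set (p.1 + t *: w, p.2 + t * c) | p in G & t in [set: R]]).
    split=> [p Gp|/(_ (w, c))].
      by exists p => //; exists 0 => //; rewrite scale0r mul0r !addr0; case: p {Gp}.
    apply: contra_not nw; move=> h; exists c; apply: h.
    by exists (0, 0) => //; exists 1 => //=; rewrite scale1r mul1r !add0r.
  split=> [p _|a _ _ [p Gp [t _ <-]] [q Gq [s _ <-]]|_ [p Gp [t _ <-]]] /=.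
  - by exists (u, `|u|) => //; exists 0; rewrite //= scale0r mul0r !addr0.
  - exists (a *: p.1 + q.1, a * p.2 + q.2); first exact: Glin.
    exists (a * t + s) => //=; congr (_, _); last by ring.
    by rewrite scalerDl scalerDr -scalerA addrACA.
  have GZ (s : R) : G (s *: p.1, s * p.2).
    by have := Glin s _ _ Gp G00; rewrite /= !addr0.
  (* Dividing by |t| reduces domination at [p.1 + t *: w] to the lower bound on [c] for negative [t]
     and to the upper bound for positive [t]. *)
  case: (ltgtP t 0) => [t0|t0|->]; last by rewrite scale0r mul0r !addr0; exact: Gdom.
  - have s0 : 0 < - t by rewrite oppr_gt0.
    have := cl _ (GZ (- t)^-1); rewrite /=.
    have -> : (- t)^-1 *: p.1 - w = (- t)^-1 *: (p.1 + t *: w).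
      by rewrite scalerDr scalerA invrN mulNr mulVf ?scaleN1r // lt_eqF.
    rewrite normrZ gtr0_norm ?invr_gt0 // -mulrBr mulrC ler_pdivrMr //.
    by lra.
  - have := cu _ (GZ t^-1); rewrite /=.
    have -> : t^-1 *: p.1 + w = t^-1 *: (p.1 + t *: w).
      by rewrite scalerDr scalerA mulVf ?scale1r // gt_eqF.
    rewrite normrZ gtr0_norm ?invr_gt0 // -mulrBr mulrC ler_pdivlMr //.
    by lra.
(* Single-valued by domination: the difference of two values at [w] is a value at 0, hence at most
   0, in both orders. *)
have Guniq w r s : G (w, r) -> G (w, s) -> r = s.
  move=> Gr Gs; have := Gdom _ (Glin (-1) _ _ Gr Gs).
  have := Gdom _ (Glin (-1) _ _ Gs Gr).
  by rewrite /= scaleN1r addNr normr0 !mulN1r; lra.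
have [f fG] := choice Gtot.
have flin (a : R) v w : f (a *: v + w) = a * f v + f w.
  exact: Guniq (fG _) (Glin a _ _ (fG v) (fG w)).
exists f; split=> [|//|v]; first exact: Guniq (fG _) G0u.
rewrite ler_norml (Gdom _ (fG v)) andbT.
have f0 : f 0 = 0 by exact: Guniq (fG _) G00.
have := Gdom _ (fG (-1 *: v + 0)); rewrite /= flin f0 !addr0 scaleN1r normrN.
by lra.
Qed.

Lemma dual_space_separates : (forall f, @dual_space R X f -> f u = 0) -> u = 0.
Proof.
move=> H; have [f [fu flin fb]] := norming_functional.
apply/eqP; rewrite -normr_eq0 -fu; apply/eqP; apply: (H f); split; first exact: flin.
have fB v w : f (v - w) = f v - f w.
  by rewrite addrC -scaleN1r flin mulN1r addrC.
move=> v; apply/cvgrPdist_lt => e e0; apply/nbhs_normP; exists e => //= w vw.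
by rewrite -fB; exact: le_lt_trans (fb _) vw.
Qed.

End HahnBanach.

(** The injection [g] reindexes a subfamily. A vector in all its tails is killed by the coordinate
    functionals, then by their linear span, its norm closure and its weak-star closure, which
    contains the whole dual. *)
Lemma M_basis_tails d (K : orderType d) (R : realType)
    (X : completeNormedModType R) (x : K -> X) d' (K' : orderType d')
    (g : K' -> K) :
  M_basis x -> injective g -> [set: K'] !=set0 ->
  \bigcap_b tail_span (x \o g) b = [set 0].
Proof.
move=> [xs [dxs xsx _ [_ wd]]] gI [b0 _]; apply/seteqP; split; last first.
  by move=> _ -> b _; apply: subspace0; exact: closed_span_subspace.
move=> u tails.
have xsu a : xs a u = 0.
  have [xlin xcont] := dxs a.
  (* By injectivity [g] meets [a] at most once, so the tail after that place avoids it; if [a] is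
     not met, any tail will do. *)
  have [b gb] : exists b, forall c, (b < c)%O -> g c != a.
    have [[b gb]|na] := pselect (exists b, g b = a).
      by exists b => c bc; rewrite -gb (inj_eq gI) gt_eqF.
    by exists b0 => c _; apply/eqP => gc; apply: na; exists c.
  suff : closed_span ((x \o g) @` [set c | (b < c)%O]) `<=` xs a @^-1` [set 0].
    by apply; exact: tails.
  apply: closed_span_min.
  - apply/linear_subspaceP; split=> /=.
      by have := xlin (-1) 0 0; rewrite scaler0 addr0 scaleN1r addNr.
    by move=> r v w v0 w0; rewrite xlin v0 w0 scaler0 addr0.
  - by apply: preimage_closed => //; exact: closed_eq.
  - by move=> _ [c bc <-] /=; rewrite xsx eq_sym (negbTE (gb _ bc)).
have spanu (f : X -> R^o) : linear_span (range xs) f -> f u = 0.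
  apply: (smallest_sub (X := [set f : X -> R^o | f u = 0])).
  - split=> [|a h k /set_mem /= h0 /set_mem /= k0]; apply: mem_set => //=.
    by have -> : (a *: h + k) u = a *: h u + k u by []; rewrite h0 k0 scaler0 addr0.
  - by move=> _ [a _ <-]; exact: xsu.
have dspanu (f : X -> R^o) : dual_closed_span (range xs) f -> f u = 0.
  move=> [_ fapp]; apply/eqP; rewrite -normr_le0; apply/ler_addgt0Pr => e e0.
  have u0 : 0 < `|u| + 1 by rewrite ltr_wpDl.
  have [h hs fh] := fapp (e / (`|u| + 1)) (divr_gt0 e0 u0).
  have := fh u; rewrite (spanu _ hs) subr0 add0r => /le_trans; apply.
  by rewrite mulrAC ler_pdivrMr // ler_wpM2l ?ltW // ltrDl.
apply: dual_space_separates => f /wd clf.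
apply/eqP; rewrite -normr_le0; apply/ler_addgt0Pr => e e0; rewrite add0r.
(* Evaluation at [u] is continuous for pointwise convergence, so some functional vanishing at [u] is
   [e]-close to [f] there. *)
have nfu : nbhs (f u : R^o) [set r : R^o | `|f u - r| < e].
  by apply/nbhs_normP; exists e.
have [h [/dspanu hu]] := clf _ (@proj_continuous X (fun=> R^o) u f _ nfu).
by rewrite /= /proj hu subr0 => /ltW.
Qed.

(** * Countable projections *)

(** The choice of [C] as 1 under (1-B) lets one construction yield both the bounded and the norm-one
    projections. *)
Lemma property_B_hull_bound (R : realType) (X : completeNormedModType R)
    d (K : orderType d) (Z : K -> closedSubspace X) :
  property_B X -> uncountable_regular K -> decreasing Z ->
  \bigcap_a Z a = [set 0] ->
  exists C : R, [/\ 0 < C, property_1B X -> C = 1 &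
    forall u, ball_hull Z u -> `|u| <= C].
Proof.
move=> BX uK decZ Z0; have [B1|nB1] := pselect (property_1B X).
  by exists 1; split=> // u; exact: B1.
have [C C0 HC] := @pinfty_ex_gt0 R _ (BX _ _ _ uK decZ Z0).
by exists C; split=> // u; exact: HC.
Qed.

Section AlephSplit.
Context {R : realType} {X : completeNormedModType R}.
Context {d : Order.disp_t} {K : orderType d}.
Variables (x : K -> X) (n : nat).
Hypotheses (BX : property_B X) (uK : uncountable_regular K).
Hypothesis hK : has_aleph n.+1 [set: K].
Hypothesis x0 : \bigcap_b tail_span x b = [set 0].

(** Common source of all three assertions: the separation from a tail gives (iii), the splitting by
    [J] gives (i) and each descent step of (ii). [J] has at most |L| elements because it is
    bounded. *)
Lemma aleph_split : exists (C : R) (L : set K),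
  [/\ 0 < C /\ (property_1B X -> C = 1), has_aleph n L,
      forall a : K, [set b | (b < a)%O] #<= L,
      forall A, A #<= L ->
        exists b, separated C (closed_span (x @` A)) (tail_span x b) &
      forall A, countable A -> exists J, [/\ A `<=` J, J #<= L &
        separated C (closed_span (x @` J)) (closed_span (x @` (~` J)))]].
Proof.
have [C [C0 C1 hullC]] :=
  property_B_hull_bound BX uK (tail_subspace_decreasing (x := x)) x0.
have [L [_ hL [_ nKL] maxL]] := hK.
have [[wK segK] _ _] := uK.
have natL := has_aleph_infinite hL; have LL := has_aleph_square wK hL.
have segL a : [set b : K | (b < a)%O] #<= L by apply: maxL => //; exact: segK.
exists C, L; split=> //; first by move=> A; exact: separated_tail.
move=> A cA; have [a0 Aa0] := countable_bounded uK cA.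
have [J [AJ [b Jb] sJ]] := separated_split uK natL LL nKL segL C0 hullC Aa0.
exists J; split=> //; apply: card_le_trans (segL b); exact: subset_card_le.
Qed.

End AlephSplit.

(** The sum on the right is closed by separation, so it contains the closed span. *)
Lemma closed_span_separated_union (R : realType) (X : completeNormedModType R)
    (A B : set X) (C : R) : 0 < C ->
  separated C (closed_span A) (closed_span B) ->
  closed_span (A `|` B) = [set w + z | w in closed_span A & z in closed_span B].
Proof.
move=> C0 sAB; have sA := closed_span_subspace A; have sB := closed_span_subspace B.
apply/seteqP; split.
  apply: closed_span_min; first exact: sumset_subspace.
    by apply: (separated_sum_closed C0 sA sB) sAB; exact: closed_closure.
  move=> u [Au|Bu].
    exists u; first exact: sub_closed_span.
    by exists 0; [exact: subspace0|rewrite addr0].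
  exists 0; first exact: subspace0.
  by exists u; [exact: sub_closed_span|rewrite add0r].
move=> _ [w Aw [z Bz <-]]; apply: (subspaceD (closed_span_subspace _)).
  by apply: closed_spanS Aw => u; left.
by apply: closed_spanS Bz => u; right.
Qed.

Lemma closed_span_projection (R : realType) (X : completeNormedModType R)
    (A B : set X) (C : R) : 0 < C ->
  separated C (closed_span A) (closed_span B) ->
  exists P, projection_onto (closed_span (A `|` B)) (closed_span A) P C.
Proof.
move=> C0 sAB; rewrite (closed_span_separated_union C0 sAB).
by apply: separated_projection => //; exact: closed_span_subspace.
Qed.

(** * Descent through the alephs, complementation and codensity *)

Section Main.
Context {R : realType} {X : completeNormedModType R}.
Context {d : Order.disp_t} {K : orderType d}.
Variable x : K -> X.

(** By induction on [n]: [B] is enumerated by an initial ordinal, regular as a successor aleph, and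
    split; the part containing [A] has at most the preceding aleph. The projections compose and
    their bounds multiply, so the bound 1 persists. *)
Lemma M_basis_countable_projection n (A B L : set K) :
  property_B X -> well_order (@Order.le d K) -> M_basis x ->
  has_aleph n L -> B #<= L -> A `<=` B -> countable A ->
  exists J, [/\ A `<=` J, countable J &
    exists P C, [/\ 0 <= C, property_1B X -> C = 1 &
      projection_onto (closed_span (x @` B)) (closed_span (x @` J)) P C]].
Proof.
move=> BX wK mx; elim: n A B L => [|n IH] A B L hL BL AB cA.
  (* At aleph-zero [B] is already countable and the identity serves. *)
  exists B; split=> //.
    by apply: card_le_trans BL _; move: hL; rewrite /= card_eq_le => /andP[].
  exists id, 1; split=> //; split=> //; first by split=> //; rewrite image_id.
  by move=> z _; rewrite mul1r.
have [LB|nLB] := pselect (L #<= B); last first.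
  by have [L' hL' BL'] := has_aleph_lt hL (conj BL nLB); exact: IH hL' BL' AB cA.
have hB : has_aleph n.+1 B by apply: has_aleph_eq hL; rewrite card_eq_le LB BL.
have [P cK' K'B] := initial_segment B wK.
have hK' : has_aleph n.+1 [set: sub_order P].
  by apply: has_aleph_eq hB; rewrite card_eq_sym.
have uK' := has_aleph_regular cK' hK'.
have [b0 Bb0] := card_le_nonempty (has_aleph_infinite hB) (ex_intro _ 0%N I).
have [k0 _] := card_le_nonempty (has_aleph_infinite hK') (ex_intro _ 0%N I).
have [g gI gB] := card_eq_range b0 K'B.
have y0 : \bigcap_b tail_span (x \o g) b = [set 0].
  by apply: M_basis_tails => //; exists k0.
have [C [L' [[C0 C1] hL' _ _ split']]] := aleph_split BX uK' hK' y0.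
have [|J' [AJ' J'L' sJ']] := split' (g @^-1` A).
  apply: sub_countable cA; apply: (@injfun_card_le _ _ _ _ g) => //.
  by move=> a b _ _; exact: gI.
have [Q Qproj] := closed_span_projection C0 sJ'.
(* The two parts together enumerate [B], so the projection is defined on the whole closed span over
   [B]. *)
have xB : ((x \o g) @` J') `|` ((x \o g) @` (~` J')) = x @` B.
  by rewrite -image_setU setUv -gB -image_comp.
rewrite xB -(image_comp g x J') in Qproj.
have gcard (S : set (sub_order P)) : g @` S #= S.
  by apply: inj_card_eq => a b _ _; exact: gI.
have hgL' : has_aleph n (g @` L') by apply: has_aleph_eq hL'; rewrite card_eq_sym.
have gJ'L' : g @` J' #<= g @` L'.
  by rewrite (card_le_eql (gcard _)) (card_le_eqr (gcard _)).
have AgJ' : A `<=` g @` J'.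
  move=> a Aa; have := AB _ Aa; rewrite -gB => -[k _ gk]; exists k => //.
  by apply: AJ'; rewrite /= gk.
have [J [AJ cJ [P' [D [D0 D1 P'proj]]]]] := IH _ _ _ hgL' gJ'L' AgJ' cA.
exists J; split=> //; exists (P' \o Q), (D * C); split.
- by rewrite mulr_ge0 // ltW.
- by move=> B1; rewrite D1 // C1 // mulr1.
- exact: (projection_comp D0 Qproj P'proj).
Qed.

(** A separable subspace lies in the span of countably many terms, and their index set is enlarged
    to a complemented countable [J]. *)
Lemma SCP_of_countable_projections :
  generating (range x) ->
  (forall A : set K, countable A -> exists J, [/\ A `<=` J, countable J &
    exists P C, (property_1B X -> C = 1) /\
      projection_onto [set: X] (closed_span (x @` J)) P C]) ->
  [/\ SCP X, SCP_within (subsequence_span x) &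
    property_1B X -> one_SCP X /\ one_SCP_within (subsequence_span x)].
Proof.
move=> gx proj.
have main (Y : set X) : linear_subspace Y -> separable_set Y ->
    exists J : set K, [/\ Y `<=` closed_span (x @` J),
      separable_set (closed_span (x @` J)) &
      exists P C, (property_1B X -> C = 1) /\
        projection_onto [set: X] (closed_span (x @` J)) P C].
  move=> _ sY; have [A cA YA] := separable_countable_support gx sY.
  have [J [AJ cJ JP]] := proj A cA; exists J; split=> //.
    by apply: subset_trans YA _; apply: closed_spanS; exact: image_subset.
  exact: separable_closed_span.
split.
- move=> Y lY sY; have [J [YJ sJ [P [C [_ PC]]]]] := main Y lY sY.
  by exists (closed_span (x @` J)); split=> //; exists P, C.
- move=> Y lY sY; have [J [YJ sJ [P [C [_ PC]]]]] := main Y lY sY.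
  by exists (closed_span (x @` J)); split=> //; [exists P, C|exists J].
- move=> B1; split=> Y lY sY; have [J [YJ sJ [P [C [/(_ B1) -> PC]]]]] := main Y lY sY.
    by exists (closed_span (x @` J)); split=> //; exists P.
  by exists (closed_span (x @` J)); split=> //; [exists P|exists J].
Qed.

(** The quotient map kills every term with index outside [T], so the images of the rational
    combinations over [T] are dense in the quotient. *)
Lemma codens_le_span (Z : closedSubspace X) (T L : set K) :
  generating (range x) -> (forall a, ~ T a -> subspace_set Z (x a)) ->
  [set: nat] #<= L -> L `*` L #<= L -> T #<= L -> codens_le Z L.
Proof.
move=> gx TZ natL LL TL; pose Q := quotient_space Z.
pose p : X -> Q := \pi_(Quotient.quot (subspace_mem Z))%qT.
have lZ := subspace_linear Z.
have pE u v : subspace_set Z (u - v) -> p u = p v.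
  move=> Zuv; have /eqP// : (u == v %[mod Quotient.quot (subspace_mem Z)])%qT.
  by rewrite -Quotient.idealrBE; exact: mem_set.
exists (p @` rat_span x T); last first.
  by apply: card_le_trans (card_image_le _ _) _; exact: card_rat_span.
move=> O [q Oq] oO.
have [u pu] : exists u, p u = q by exists (repr q); rewrite /p reprK.
have : closure (rat_span x setT) u by apply: closed_span_sub_rat_span; rewrite gx.
have nO : nbhs u (p @^-1` O) by apply: open_nbhs_nbhs; split=> //=; rewrite pu.
move=> /(_ _ nO) [v [[s _ <-] Os]].
(* The discarded terms belong to [Z], so the class is unchanged. *)
pose s' := [seq t <- s | `[< T t.2 >]].
exists (p (rat_comb x s)); split=> //.
exists (rat_comb x s').
  by exists s' => // t; rewrite mem_filter => /andP[/asboolP].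
apply/esym/pE; rewrite /rat_comb big_filter.
rewrite [X in X - _](bigID (fun t => `[< T t.2 >])) /= addrAC subrr add0r.
apply: (big_ind (subspace_set Z)); first exact: subspace0.
  by move=> ? ?; exact: subspaceD.
by move=> t /asboolP /TZ; exact: subspaceZ.
Qed.

End Main.

Theorem theorem3p4 (R : realType) (X : completeNormedModType R)
    (d : Order.disp_t) (K : orderType d) (x : K -> X) :
  infinite_dimensional X ->
  uncountable_regular K ->
  property_B X ->
  generating (range x) ->
  strongly_dispersed x ->
  [/\ (* (i) *)
      has_aleph 1 [set: K] ->
        [/\ SCP X, SCP_within (subsequence_span x) &
            property_1B X -> one_SCP X /\ one_SCP_within (subsequence_span x)],
      (* (ii) *)
      lt_aleph_omega [set: K] -> M_basis x ->
        [/\ SCP X, SCP_within (subsequence_span x) &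
            property_1B X -> one_SCP X /\ one_SCP_within (subsequence_span x)] &
      (* (iii) *)
      forall k : nat, (0 < k)%N -> has_aleph k [set: K] ->
      forall Y : set X, linear_subspace Y -> separable_set Y ->
      exists (Z : closedSubspace X) (W : set X),
        [/\ exists2 L : set K, has_aleph k.-1 L & codens_le Z L,
            separable_set W, Y `<=` W, complemented_in Z W &
            subsequence_span x W]].
Proof.
move=> _ uK BX gx [x0 _]; have [[wK _] ncK _] := uK.
split.
(* Here [L] is countable, so one splitting already yields a countable [J]. *)
- move=> hK; have [C [L [[C0 C1] hL _ _ splitK]]] := aleph_split BX uK hK x0.
  apply: SCP_of_countable_projections => // A cA.
  have [J [AJ JL sJ]] := splitK A cA; exists J; split=> //.
    by apply: card_le_trans JL _; move: hL; rewrite /= card_eq_le => /andP[].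
  have [P PC] := closed_span_projection C0 sJ; exists P, C; split=> //.
  by rewrite -image_setU setUv gx in PC.
- move=> [/finite_set_countable//|[n hK]] mx.
  apply: SCP_of_countable_projections => // A cA.
  have [J [AJ cJ [P [C [_ C1 PC]]]]] :=
    M_basis_countable_projection BX wK mx hK (card_lexx _) (@subsetT _ A) cA.
  by exists J; split=> //; exists P, C; rewrite gx in PC.
- move=> [//|k] _ hK Y lY sY.
  have [C [L [[C0 _] hL segL tailL _]]] := aleph_split BX uK hK x0.
  have natL := has_aleph_infinite hL.
  have [A cA YA] := separable_countable_support gx sY.
  have [b sb] := tailL A (card_le_trans cA natL).
  have [P PC] := closed_span_projection C0 sb.
  (* [Z] is spanned by the terms over [A] and those after [b]; only indices up to [b] can be
     missing, which bounds the codensity. *)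
  set B := _ `|` _ in PC.
  exists (ClosedSubspace (closed_span_subspace B) (@closed_span_closed R X _)).
  exists (closed_span (x @` A)); split=> //; last by exists A.
  + exists L => //; apply: (@codens_le_span _ _ _ _ _ _ [set a | (a <= b)%O]) gx _ natL _ _.
    * move=> a /negP; rewrite -ltNge => ba; apply: sub_closed_span; right.
      by exists a.
    * exact: has_aleph_square wK hL.
    (* [segL] concerns strict segments, so the closed segment up to [b] is placed in the strict one
       below a larger [c]. *)
    * have [c bc] := countable_bounded uK (countable1 b).
      apply: card_le_trans (segL c); apply: subset_card_le => a /= ab.
      by apply: le_lt_trans ab _; apply: bc.
  + exact: separable_closed_span.
  + by exists P, C.
Qed.
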